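(* For every theory $\Gamma$ and every sentence $\varphi$ of $\mathcal{L}_{4.5}^+$: if $\Gamma\models\varphi$, then $\Gamma\vdash\varphi$.
   Context: Syntax of $\mathcal{L}_{4.5}^+$. Fix a set $P$ of nouns and a set $R$ of verbs. Terms: every noun is a term; if $x$ is a term and $r\in R$ then $(r\ \mathsf{all}\ x)$ and $\overline{x}$ are terms. Sentences: $[x_1,\dots,x_n]$ and $\langle x_1,\dots,x_n\rangle$ for all $n\ge1$ and terms $x_1,\dots,x_n$. A theory is a set of sentences. Semantics. A model $\mathcal{M}$ is a set $M$ (possibly empty) with $[\![p]\!]\subseteq M$ for $p\in P$ and $[\![r]\!]\subseteq M\times M$ for $r\in R$; $[\![r\ \mathsf{all}\ x]\!]=\{m\in M: m\,[\![r]\!]\,n\text{ for all }n\in[\![x]\!]\}$; $[\![\overline{x}]\!]=M\setminus[\![x]\!]$. $\mathcal{M}\models[x_1,\dots,x_n]$ iff $\bigcap_{i=1}^n[\![x_i]\!]=\emptyset$; $\mathcal{M}\models\langle x_1,\dots,x_n\rangle$ iff $\bigcap_{i=1}^n[\![x_i]\!]\neq\emptyset$. $\Gamma\models\varphi$ means every model of $\Gamma$ satisfies $\varphi$. Proof rules. $\Gamma\vdash\varphi$ means there is a finite derivation of $\varphi$ with non-withdrawn assumptions in $\Gamma$ using: (axiom) infer $[x,\overline{x}]$ from no premises; (res) from $[x,y_1,\dots,y_n]$ and $[\overline{x},z_1,\dots,z_m]$ infer $[y_1,\dots,y_n,z_1,\dots,z_m]$; (rel) from $[\overline{x_1},\dots,\overline{x_{n-1}},x_n]$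 infer $[(r\ \mathsf{all}\ x_1),\dots,(r\ \mathsf{all}\ x_{n-1}),\overline{(r\ \mathsf{all}\ x_n)}]$; (structural) from $[x_1,\dots,x_m]$ infer $[y_1,\dots,y_n]$, provided each $x_i$ is identical to some $y_j$; (efq) from $\langle y_1,\dots,y_m\rangle$ and $[y_1,\dots,y_m]$ infer $[x_1,\dots,x_n]$; (raa) given derivations of $\langle y_1,\dots,y_m\rangle$ and of $[y_1,\dots,y_m]$, both from $\Gamma\cup\{[x_1,\dots,x_n]\}$, conclude $\langle x_1,\dots,x_n\rangle$ from $\Gamma$ (withdrawing the assumption $[x_1,\dots,x_n]$). In (res) $n$ or $m$ may be $0$ as long as the conclusion is a nonempty list; in (rel) $n\ge1$. *)

(* Defs.v *)
From mathcomp Require Import all_boot.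
From mathcomp Require Import boolp classical_sets.
From Stdlib Require List.

Set Implicit Arguments.
Unset Strict Implicit.
Unset Printing Implicit Defensive.

Local Open Scope classical_set_scope.

(* The tuples of terms occurring in sentences have length at least 1. *)
Record nelist (T : Type) := NeList { nehead : T; netail : seq T }.

Definition seq_of_nelist (T : Type) (s : nelist T) : seq T :=
  nehead s :: netail s.
Coercion seq_of_nelist : nelist >-> seq.

Section Syntax.
Variables P R : Type.

Inductive term :=
| Noun of P
| RAll of R & term
| Compl of term.

(* [Disj xs] is [x_1, ..., x_n] (empty intersection);
   [Meet xs] is <x_1, ..., x_n> (nonempty intersection). *)
Inductive sentence :=
| Disj of nelist term
| Meet of nelist term.

(* The side equations only assert that a list displayed in a rule is the
   nonempty list of a sentence; in [d_res] this is exactly the proviso that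
   the conclusion be nonempty. *)
Inductive derives : set sentence -> sentence -> Prop :=
| d_hyp (Gamma : set sentence) phi :
    Gamma phi -> derives Gamma phi
| d_axiom Gamma x :
    derives Gamma (Disj (NeList x [:: Compl x]))
| d_res Gamma x ys zs (ws : nelist term) :
    ws = ys ++ zs :> seq term ->
    derives Gamma (Disj (NeList x ys)) ->
    derives Gamma (Disj (NeList (Compl x) zs)) ->
    derives Gamma (Disj ws)
| d_rel Gamma r xs x (us vs : nelist term) :
    us = rcons (map Compl xs) x :> seq term ->
    vs = rcons (map (RAll r) xs) (Compl (RAll r x)) :> seq term ->
    derives Gamma (Disj us) ->
    derives Gamma (Disj vs)
| d_struct Gamma (xs ys : nelist term) :
    List.incl xs ys ->
    derives Gamma (Disj xs) ->
    derives Gamma (Disj ys)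
| d_efq Gamma ys xs :
    derives Gamma (Meet ys) ->
    derives Gamma (Disj ys) ->
    derives Gamma (Disj xs)
| d_raa Gamma ys xs :
    derives (Gamma `|` [set Disj xs]) (Meet ys) ->
    derives (Gamma `|` [set Disj xs]) (Disj ys) ->
    derives Gamma (Meet xs).

End Syntax.

Section Semantics.
Variables P R : Type.

(* The domain may be empty. *)
Record model := Model {
  dom : Type;
  noun_interp : P -> set dom;
  verb_interp : R -> set (dom * dom)
}.

Fixpoint interp (M : model) (x : term P R) : set (dom M) :=
  match x with
  | Noun p => noun_interp p
  | RAll r y =>
      [set m : dom M | forall n : dom M, interp y n -> verb_interp r (m, n)]
  | Compl y => ~` interp y
  end.

Definition interp_meet (M : model) (xs : nelist (term P R)) : set (dom M) :=
  \bigcap_(x in [set x | List.In x xs]) interp x.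

Definition satisfies (M : model) (phi : sentence P R) : Prop :=
  match phi with
  | Disj xs => @interp_meet M xs = set0
  | Meet xs => @interp_meet M xs <> set0
  end.

Definition entails (Gamma : set (sentence P R)) (phi : sentence P R) : Prop :=
  forall M : model,
    (forall psi, Gamma psi -> satisfies M psi) -> satisfies M phi.

End Semantics.

(* Main.v *)
Require Import Defs.
From mathcomp Require Import all_boot.
From mathcomp Require Import boolp classical_sets.
From Stdlib Require List.

(** Completeness by a canonical model.  Fix a theory [Gamma].  A set of terms
    is consistent when no sentence [[x_1, ..., x_n]] with all [x_i] in the set
    is derivable from [Gamma], and a type is a consistent set containing [x] or
    its complement for every term [x].  By Zorn's lemma and (res), every
    nonempty consistent set extends to a type ([consistent_sub_type]).

    The canonical model has the types as points; a noun holds at the types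
    containing it, and [S] is [r]-related to [T] when [S] contains some
    [r all x] with [x] in [T].  The truth lemma ([interp_canonical]) says that
    a type satisfies exactly the terms it contains.  Its only substantial case
    is [r all x]: if [r all x] is not in [S], then (rel) and the consistency of
    [S] show that [x] together with the complements of all [y] such that
    [r all y] is in [S] form a consistent set, and a type extending it contains
    [x] without being [r]-related to [S].

    Hence the model satisfies [[xs]] iff [Gamma] derives it
    ([canonical_Disj]).  So it is a model of [Gamma] as soon as [Gamma] derives
    no [[ys]] for which it contains [<ys>].  If [Gamma] does not derive [[xs]],
    this condition holds by (efq), and the canonical model of [Gamma] refutes
    [[xs]].  If [Gamma] does not derive [<xs>], the condition holds by (raa) for
    [Gamma] extended with [[xs]], whose canonical model refutes [<xs>]. *)

Set Implicit Arguments.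
Unset Strict Implicit.
Unset Printing Implicit Defensive.

Local Open Scope classical_set_scope.

Lemma incl_cons_map (T U : Type) (f : U -> T) (B : set U) (x : T) (s : seq T) :
  (forall t, List.In t s -> t = x \/ (f @` B) t) ->
  exists2 us : seq U, (forall u, List.In u us -> B u) &
    List.incl s (x :: map f us).
Proof.
elim: s => [|t s IHs] st; first by exists [::].
have [|us usB s_us] := IHs; first by move=> t' t's; apply: st; right.
have [->|[u Bu <-]] : t = x \/ (f @` B) t by apply: st; left.
- by exists us => // t' [<-|/s_us //]; left.
- exists (u :: us) => [u' [<- //|/usB //]|t' [<-|/s_us[<-|t'us]]].
  + by right; left.
  + by left.
  + by right; right.
Qed.

Lemma In_cat (T : Type) (x : T) (s t : seq T) :
  List.In x (s ++ t) <-> List.In x s \/ List.In x t.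
Proof. exact: List.in_app_iff. Qed.

Lemma rcons_nelist (T : Type) (s : seq T) (x : T) :
  exists us : nelist T, us = rcons s x :> seq T.
Proof.
by case: s => [|y s]; [exists (NeList x [::]) | exists (NeList y (rcons s x))].
Qed.

(** The empty set is allowed as a bound so that [F] itself may be empty. *)
Lemma chain_list_sub (T : Type) (F : set (set T)) (A : set T) (s : seq T) :
  total_on F subset ->
  (forall x, List.In x s -> (A `|` \bigcup_(X in F) X) x) ->
  exists2 X, X = set0 \/ F X & forall x, List.In x s -> (A `|` X) x.
Proof.
move=> Ftot; elim: s => [|t s IHs] st; first by exists set0; [left|].
have [|X FX sX] := IHs; first by move=> x xs; apply: st; right.
have [At|[Y FY Yt]] : (A `|` \bigcup_(X in F) X) t by apply: st; left.
  by exists X => // x [<-|/sX //]; left.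
have [XY|YX] : X `<=` Y \/ Y `<=` X.
  by case: FX => [->|FX]; [left | apply: Ftot].
- by exists Y => [|x [<-|/sX[Ax|/XY Yx]]]; by [right|left].
- by exists X => // x [<-|/sX //]; right; apply: YX.
Qed.

Section Canonical.
Variables (P R : Type) (Gamma : set (sentence P R)).
Implicit Types (A S T : set (term P R)) (x y : term P R).

Definition consistent A : Prop :=
  forall xs : nelist (term P R),
    (forall x, List.In x xs -> A x) -> ~ derives Gamma (Disj xs).

(** Maximal consistent sets of terms. *)
Definition is_type S : Prop :=
  consistent S /\ forall x, S x \/ S (Compl x).

(** The assumption that [A] has an element is needed because (res) yields
    nothing from the sentences [[x]] and [[Compl x]]: the side formula [z]
    keeps the conclusion nonempty. *)
Lemma consistent_cut A x z :
  consistent A -> A z -> consistent (x |` A) \/ consistent (Compl x |` A).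
Proof.
move=> Acons Az; apply: contrapT => /not_orP[].
move=> /existsNP[s /not_implyP[sA /contrapT ds]].
move=> /existsNP[t /not_implyP[tA /contrapT dt]].
have [t' /sA[->|At']|ys ysA s_ys] := @incl_cons_map _ _ id A x s.
- by left.
- by right; exists t'.
have [t' /tA[->|At']|zs zsA t_zs] := @incl_cons_map _ _ id A (Compl x) t.
- by left.
- by right; exists t'.
move: s_ys t_zs; rewrite !map_id => s_ys t_zs.
apply: (Acons (NeList z (ys ++ zs))).
  by move=> u [<- //|/In_cat[/ysA|/zsA]].
apply: (@d_res _ _ _ x (z :: ys) zs) => //.
- by apply: d_struct ds => u /s_ys[<-|uys]; [left | right; right].
- by apply: d_struct dt.
Qed.

Lemma consistent_sub_type A z :
  consistent A -> A z -> exists2 S, A `<=` S & is_type S.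
Proof.
move=> Acons Az.
have [F FQ Ftot|B [ABcons Bmax]] :=
    @Zorn_bigcup _ [set B | consistent (A `|` B)].
  move=> s /(chain_list_sub Ftot)[X [->|/FQ Xcons] sX]; last exact: Xcons.
  by apply: Acons => x /sX[].
exists (A `|` B); first by move=> x; left.
split=> // x.
have absorb y : consistent (y |` (A `|` B)) -> (A `|` B) y.
  move=> ycons; right; apply: contrapT => nBy.
  apply: (Bmax (y |` B)); last by rewrite /= setUCA.
  by split=> [u Bu|/(_ y)yB]; [right | apply/nBy/yB; left].
by have [||/absorb|/absorb] := @consistent_cut (A `|` B) x z; auto; left.
Qed.

Lemma consistent_list (xs : nelist (term P R)) :
  ~ derives Gamma (Disj xs) -> consistent [set x | List.In x xs].
Proof. by move=> nxs ys ysxs dys; apply: nxs; apply: d_struct dys. Qed.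

Lemma type_Compl S x : is_type S -> S (Compl x) <-> ~ S x.
Proof.
move=> [Scons Scompl]; split=> [SCx Sx|nSx]; last by case: (Scompl x).
apply: (Scons (NeList x [:: Compl x])); last exact: d_axiom.
by move=> y [<- //|[<- //|[]]].
Qed.

(** A type omitting [r all x] has an [x]-point to which it is not related. *)
Lemma type_RAll_witness S r x : is_type S -> ~ S (RAll r x) ->
  exists T, [/\ is_type T, T x & forall y, S (RAll r y) -> ~ T y].
Proof.
move=> Stype nSrx; pose B := [set y | S (RAll r y)].
have [s sB ds||T xBT Ttype] :=
    @consistent_sub_type (x |` ((@Compl P R) @` B)) x; last 1 first.
- exists T; split=> //; first by apply: xBT; left.
  move=> y Sry; apply/(type_Compl _ Ttype)/xBT; right.
  by exists y.
- have [t /sB[->|]|ys ysB s_ys] := @incl_cons_map _ _ (@Compl P R) B x s.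
  + by left.
  + by right.
  (* A derivation of [s] weakens to one of [Compl y_1, ..., Compl y_n, x],
     from which (rel) derives a sentence whose terms all belong to [S]. *)
  have [us Eus] := rcons_nelist (map (@Compl P R) ys) x.
  have [vs Evs] := rcons_nelist (map (RAll r) ys) (Compl (RAll r x)).
  case: (Stype) => Scons _; apply: (Scons vs).
    move=> y; rewrite Evs -cats1 => /In_cat[|[<-|[]]].
      by move=> /List.in_map_iff[u [<- /ysB]].
    exact/(type_Compl _ Stype).
  apply: (d_rel Eus Evs); apply: d_struct ds => t /s_ys ts.
  rewrite Eus -cats1; apply/In_cat.
  by case: ts => [<-|]; [right; left | left].
- by left.
Qed.

(** The points are the types; relations hold only where some [r all x]
    forces them to. *)
Definition canonical : model P R :=
  @Model P R {S | is_type S}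
    (fun p => [set S | sval S (Noun R p)])
    (fun r => [set ST | exists2 x, sval ST.1 (RAll r x) & sval ST.2 x]).

Lemma interp_canonical x (S : dom canonical) :
  @interp P R canonical x S <-> sval S x.
Proof.
elim: x S => [p|r x IHx|x IHx] S //=; last first.
  by rewrite (type_Compl _ (svalP S)) -IHx.
split=> [Srx|Srx T /IHx Tx]; last by exists x.
apply: contrapT => /(type_RAll_witness (svalP S))[T [Ttype Tx nT]].
have /IHx/Srx[y Sry Ty] : sval (exist _ T Ttype : dom canonical) x by [].
exact: nT Sry Ty.
Qed.

Lemma canonical_Disj (xs : nelist (term P R)) :
  satisfies canonical (Disj xs) <-> derives Gamma (Disj xs).
Proof.
split=> [/= xs0|dxs].
- apply: contrapT => /consistent_list xscons.
  have [|S xsS Stype] := @consistent_sub_type _ (nehead xs) xscons.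
    by left.
  suff : @interp_meet P R canonical xs (exist _ S Stype) by rewrite xs0.
  by move=> x /xsS Sx; apply/interp_canonical.
- rewrite /= -subset0 => S xsS.
  have [Scons _] := svalP S; apply: Scons dxs => x xxs.
  exact/interp_canonical/xsS.
Qed.

Lemma canonical_model :
  (forall ys, Gamma (Meet ys) -> ~ derives Gamma (Disj ys)) ->
  forall psi, Gamma psi -> satisfies canonical psi.
Proof.
move=> Gcons [xs Gxs|ys /Gcons nys]; last by move=> /canonical_Disj.
exact/canonical_Disj/d_hyp.
Qed.

End Canonical.

Theorem theorem4p11 (P R : Type) (Gamma : set (sentence P R))
    (phi : sentence P R) :
  entails Gamma phi -> derives Gamma phi.
Proof.
case: phi => xs Gxs; apply: contrapT => nxs.
- apply/nxs/canonical_Disj/Gxs/canonical_model => ys Gys dys.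
  exact/nxs/(d_efq _ _ dys)/d_hyp.
- pose Gamma' := Gamma `|` [set Disj xs].
  have Gcons ys : Gamma' (Meet ys) -> ~ derives Gamma' (Disj ys).
    by move=> Gys dys; apply/nxs/(d_raa _ dys)/d_hyp.
  have sat := canonical_model Gcons.
  apply: (Gxs (canonical Gamma')) => [psi Gpsi|]; first by apply: sat; left.
  by apply: (sat (Disj xs)); right.
Qed.
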